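(* Let $\mathcal{K}$ be the class of complete graphs. For every integer $k\ge 2$, $r_k(\mathcal{K})\ge \frac{3}{2}$.
   Context: All graphs are finite and simple. Let $G$ be a graph and $k\ge 2$ an integer. A multiset $\mathscr{P}$ of paths in $G$ is a $k$-rainbow separating path system ($k$-RSPS) if its elements can be colored with (at most) $k$ colors so that for every pair of distinct edges $e_1,e_2\in E(G)$ there exist paths $P_1,P_2\in\mathscr{P}$ of distinct colors such that $P_1$ contains $e_1$ but not $e_2$, and $P_2$ contains $e_2$ but not $e_1$. The $k$-rainbow separation number $c_k(G)$ is the smallest cardinality (with multiplicity) of a $k$-RSPS of $G$. Write $c_\infty(G)$ for the strong separation number of $G$: the least size of a set of paths of $G$ such that for every ordered pair $(e,f)$ of distinct edges some path in the set contains $e$ and avoids $f$. The $k$-rainbow separation ratio of $G$ (with at least two edges) is $r_k(G)=c_k(G)/c_\infty(G)$. For a class (infinite family) $\Sigma$ of graphs, $r_k(\Sigma)=\limsup_{G\in\Sigma} r_k(G)$, the limsup being taken as $|V(G)|\to\infty$ over $G\in\Sigma$. *)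

(* Defs.v *)
From HB Require Import structures.
From mathcomp Require Import all_boot all_order all_algebra.
From mathcomp Require Import boolp classical_sets reals constructive_ereal ereal.

Set Implicit Arguments.
Unset Strict Implicit.
Unset Printing Implicit Defensive.

Import Order.TTheory GRing.Theory Num.Theory.

Local Open Scope nat_scope.

Record sgraph := SGraph {
  vertex : finType;
  adj : rel vertex;
  adj_sym : symmetric adj;
  adj_irr : irreflexive adj }.

Definition edges (G : sgraph) : {set {set vertex G}} :=
  [set [set p.1; p.2] | p : vertex G * vertex G & adj p.1 p.2].

(* A pair (vertex set, edge set). Paths are represented as subgraphs, so that
   a vertex sequence and its reversal count as the same path. *)
Definition subgraph (G : sgraph) : finType :=
  ({set vertex G} * {set {set vertex G}})%type.

Definition is_path (G : sgraph) (H : subgraph G) : Prop :=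
  exists (x : vertex G) (p : seq (vertex G)),
    [/\ path (@adj G) x p, uniq (x :: p),
        H.1 = [set v in x :: p] &
        H.2 = [set e in pairmap (fun u v => [set u; v]) x p]].

(* The multiset of paths is an indexed family, so that copies of the same path
   may receive different colors. *)
Definition is_rsps (k : nat) (G : sgraph) (n : nat) (P : 'I_n -> subgraph G)
    : Prop :=
  (forall i, is_path (P i)) /\
  exists col : 'I_n -> 'I_k,
    forall e1 e2, e1 \in edges G -> e2 \in edges G -> e1 <> e2 ->
    exists i j, [/\ col i <> col j,
                    e1 \in (P i).2, e2 \notin (P i).2,
                    e2 \in (P j).2 & e1 \notin (P j).2].

Definition is_strong_separating (G : sgraph) (S : {set subgraph G}) : Prop :=
  (forall H, H \in S -> is_path H) /\
  forall e f, e \in edges G -> f \in edges G -> e <> f ->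
  exists H, [/\ H \in S, e \in H.2 & f \notin H.2].

(* The value 0 is a dummy for the empty predicate. *)
Definition least (P : nat -> Prop) : nat :=
  if pselect (exists n, `[< P n >]) is left exP then ex_minn exP else 0.

Definition rainbow_sep_num (k : nat) (G : sgraph) : nat :=
  least (fun n => exists P : 'I_n -> subgraph G, is_rsps k P).

Definition strong_sep_num (G : sgraph) : nat :=
  least (fun n => exists2 S : {set subgraph G}, is_strong_separating S & #|S| = n).

Definition rainbow_ratio (R : realType) (k : nat) (G : sgraph) : R :=
  ((rainbow_sep_num k G)%:R / (strong_sep_num G)%:R)%R.

(* The limsup as #|V(G)| tends to infinity over the G in Sigma for which the
   ratio is defined, i.e., those with at least two edges. Sigma cannot have type
   [set sgraph], for lack of universe room, so it is a plain predicate. *)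
Definition class_rainbow_ratio (R : realType) (k : nat) (Sigma : sgraph -> Prop)
    : \bar R :=
  ereal_inf [set ereal_sup
    [set r : \bar R | exists G : sgraph,
      [/\ Sigma G, 2 <= #|edges G|, N <= #|vertex G| &
          r = (rainbow_ratio R k G)%:E%E]]%classic
    | N in [set: nat]]%classic.

Definition complete_graphs (G : sgraph) : Prop :=
  forall x y : vertex G, x <> y -> adj x y.

Lemma leastP (P : nat -> Prop) : (exists n, P n) ->
  P (least P) /\ forall n, P n -> least P <= n.
Proof.
move=> [n Pn]; rewrite /least; case: pselect => [exP|[]]; last first.
  by exists n; apply/asboolP.
case: ex_minnP => m /asboolP Pm min_m; split=> // i Pi.
exact/min_m/asboolP.
Qed.

Lemma edge_is_path (G : sgraph) (e : {set vertex G}) : e \in edges G ->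
  exists2 H : subgraph G, is_path H & H.2 = [set e].
Proof.
case/imsetP=> -[x y]; rewrite inE /= => adjxy ->.
exists ([set v in [:: x; y]], [set [set x; y]]) => //; exists x, [:: y].
split=> //=; first by rewrite adjxy.
  rewrite inE andbT; apply/eqP => eqxy.
  by move: adjxy; rewrite eqxy adj_irr.
by apply/setP => f; rewrite !inE.
Qed.

Lemma rainbow_sep_numP (k : nat) (G : sgraph) : 2 <= k ->
  (exists P : 'I_(rainbow_sep_num k G) -> subgraph G, is_rsps k P) /\
  forall n (P : 'I_n -> subgraph G), is_rsps k P -> rainbow_sep_num k G <= n.
Proof.
move=> k2; suff ex : exists n (P : 'I_n -> subgraph G), is_rsps k P.
  have [? min] := leastP ex; split=> // n P HP.
  by apply: min; exists P.
pose A := [set u : subgraph G * bool | `[< is_path u.1 >]].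
exists #|A|, (fun i => (enum_val i).1); split.
  by move=> i; have := enum_valP i; rewrite inE => /asboolP.
case: k k2 => [|[|k]] // _.
exists (fun i => if (enum_val i).2 then ord0 else ord_max) => e1 e2 E1 E2 ne.
have [H1 pH1 eH1] := edge_is_path E1; have [H2 pH2 eH2] := edge_is_path E2.
have A1 : (H1, true) \in A by rewrite inE; apply/asboolP.
have A2 : (H2, false) \in A by rewrite inE; apply/asboolP.
exists (enum_rank_in A1 (H1, true)), (enum_rank_in A1 (H2, false)).
rewrite !enum_rankK_in //= eH1 eH2 !inE !eqxx.
by split=> //; apply/eqP => // eq12; apply: ne.
Qed.

Lemma strong_sep_numP (G : sgraph) :
  (exists2 S : {set subgraph G}, is_strong_separating S &
     #|S| = strong_sep_num G) /\
  forall S : {set subgraph G}, is_strong_separating S ->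
    strong_sep_num G <= #|S|.
Proof.
suff ex : exists n, exists2 S : {set subgraph G},
    is_strong_separating S & #|S| = n.
  have [? min] := leastP ex; split=> // S HS.
  by apply: min; exists S.
exists #|[set H : subgraph G | `[< is_path H >]]|.
exists [set H : subgraph G | `[< is_path H >]] => //; split=> [H|e f E F ne].
  by rewrite inE => /asboolP.
have [H pH eH] := edge_is_path E; exists H; rewrite eH !inE eqxx.
by split=> //; apply/eqP => eqfe; apply: ne.
Qed.

(* Main.v *)
From mathcomp Require Import all_solvable all_field ring lra zify.
Require Import Defs.
From mathcomp Require Import all_boot all_order all_algebra.
From mathcomp Require Import boolp classical_sets reals constructive_ereal ereal.

(** Write [m] for the [k]-rainbow and [s] for the strong separation number of
    the complete graph on [p] vertices. It is enough to treat the primes [p],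
    for which [2 m >= 3 p - O(k)] and [s <= p + 2].

    Lower bound on [m]. If almost every edge lies on at least three of the [m]
    paths, then counting incidences gives [3 p (p-1) / 2 <= m (p-1)] up to
    lower order terms. Now let [e] lie on at most two paths, and label it by
    one of these paths and the color of the other. If [e] and [f] had the same
    label [(i, c)], then path [i] would contain both, so only the remaining
    path of [e] could contain [e] and avoid [f], and vice versa; but both
    remaining paths have color [c], while a rainbow system separates [e] and [f]
    by paths of distinct colors. Hence there are at most [m k] such edges
    ([card_thin_edges]), which gives [rsps_lower_bound].

    Upper bound on [s]. Let [g] be a primitive root modulo [p]. The [p]
    translates of the cycle [1, g, g^2, ..., g^(p-2)] in F_p form an orthogonal
    double cover of the complete graph: the differences [g^i (g-1)] of
    consecutive vertices run through all nonzero residues, so every edge lies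
    on exactly two translates, one for each orientation, and two distinct
    translates share exactly one edge ([power_paths_meet]). Thus the two
    translates through [e] separate it from every other edge. To obtain paths,
    delete from each cycle its closing edge [{g^(p-2), 1}]. The deleted edges
    are the edges [{x, x + d}] with [d = 1 - 1/g]. As [p] is prime, these
    edges form a Hamilton cycle, which two more paths cover; these two separate
    its edges from all the others. Each translated path still contains exactly
    one edge of the Hamilton cycle, so the edges of this cycle are separated
    from one another as well. *)

Set Implicit Arguments.
Unset Strict Implicit.
Unset Printing Implicit Defensive.

Import Order.TTheory GRing.Theory Num.Theory.

Local Open Scope nat_scope.

(** * The lower bound for rainbow separation *)

Lemma card_path_edges (G : sgraph) (H : subgraph G) :
  is_path H -> #|H.2| <= #|vertex G|.-1.
Proof.
case=> x [p [_ uniq_xp _ ->]]; rewrite cardsE.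
apply: leq_trans (card_size _) _; rewrite size_pairmap.
rewrite -[size p]/(size (x :: p)).-1 -(card_uniqP uniq_xp).
by rewrite -!subn1 leq_sub2r ?max_card.
Qed.

(** An edge on at most two paths is determined by one of these paths together
    with the color of the other: two edges with the same such label could only
    be separated from each other by paths of the same color. *)
Lemma card_thin_edges (k : nat) (G : sgraph) (n : nat)
    (P : 'I_n -> subgraph G) :
    is_rsps k P -> 1 < #|edges G| ->
  #|[set e in edges G | #|[set i | e \in (P i).2]| <= 2]| <= n * k.
Proof.
case=> _ [col sep] E_gt1; set thin := [set e in _ | _].
pose label e (ic : 'I_n * 'I_k) := (e \in (P ic.1).2) &&
  [forall j, (e \in (P j).2) ==> (j != ic.1) ==> (col j == ic.2)].
(* If [e] lies on a single path, then any color serves as second component. *)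
have has_label e : e \in thin -> exists ic, label e ic.
  rewrite inE => /andP[Ee thin_e].
  have [f Ef ne_fe] : exists2 f, f \in edges G & f <> e.
    have /card_gt0P[f] : 0 < #|edges G :\ e|.
      by have := cardsD1 e (edges G); rewrite Ee; lia.
    by rewrite !inE => /andP[/eqP ? ?]; exists f.
  have [i [_ [_ ei _ _ _]]] := sep e f Ee Ef (nesym ne_fe).
  have le1 : #|[set i | e \in (P i).2] :\ i| <= 1.
    by move: thin_e; rewrite (cardsD1 i) inE ei.
  case: (set_0Vmem ([set i | e \in (P i).2] :\ i)) => [none | [j ej]].
    exists (i, col i); rewrite /label ei /=; apply/forallP => j.
    apply/implyP => ej; apply/implyP => ne_ji.
    by move: none => /setP/(_ j); rewrite !inE ne_ji ej.
  exists (i, col j); rewrite /label ei /=; apply/forallP => l.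
  apply/implyP => el; apply/implyP => ne_li.
  have /card_le1_eqP/(_ l j) -> // := le1.
  by rewrite !inE ne_li.
have [-> | [e0 /has_label[ic0 _]]] := set_0Vmem thin; first by rewrite cards0.
pose f e := odflt ic0 [pick ic | label e ic].
have fP e : e \in thin -> label e (f e).
  move=> /has_label[ic e_ic]; rewrite /f; case: pickP => //= /(_ ic).
  by rewrite e_ic.
suff inj_f : {in thin &, injective f}.
  by have := @leq_card_in _ _ f (mem thin) inj_f; rewrite card_prod !card_ord.
move=> e1 e2 T1 T2 eq_f; apply: contrapT => ne12.
have /andP[e1i /forallP lab1] := fP _ T1.
have /andP[e2i /forallP lab2] := fP _ T2; rewrite -eq_f in e2i lab2.
move: T1 T2; rewrite !inE => /andP[E1 _] /andP[E2 _].
have [i [j [ne_col e1_i e2_i e2_j e1_j]]] := sep _ _ E1 E2 ne12.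
apply: ne_col.
have /eqP-> : col i == (f e1).2.
  apply: implyP (implyP (lab1 i) e1_i) _.
  by apply: contraNneq e2_i => ->.
apply/esym/eqP; apply: implyP (implyP (lab2 j) e2_j) _.
by apply: contraNneq e1_j => ->.
Qed.

(** Double counting of the incidences between edges and paths: every edge that
    is not thin contributes at least three. *)
Lemma rsps_lower_bound (k : nat) (G : sgraph) (n : nat)
    (P : 'I_n -> subgraph G) :
    is_rsps k P -> 1 < #|edges G| ->
  3 * #|edges G| <= n * (#|vertex G|.-1 + 3 * k).
Proof.
move=> rsps E_gt1; have [pathP _] := rsps.
have thin_le := card_thin_edges rsps E_gt1.
set thin := [set e in _ | _] in thin_le.
have incidences :
    \sum_(e in edges G) #|[set i | e \in (P i).2]| <= n * #|vertex G|.-1.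
  under eq_bigr => e _ do rewrite -sum1dep_card big_mkcond.
  rewrite exchange_big /= -[n in n * _]card_ord -sum_nat_const.
  apply: leq_sum => i _; apply: leq_trans (card_path_edges (pathP i)).
  rewrite -big_mkcondr /= sum1dep_card; apply: subset_leq_card.
  by apply/fintype.subsetP => e; rewrite inE => /andP[].
have : \sum_(e in edges G) 3 <=
    \sum_(e in edges G) (#|[set i | e \in (P i).2]| + 3 * (e \in thin)).
  apply: leq_sum => e Ee; rewrite inE Ee /=.
  by set d := #|_|; case: (leqP d 2) => ?; lia.
rewrite sum_nat_const big_split /= -big_distrr /=.
have -> : \sum_(e in edges G) (e \in thin : nat) = #|thin|.
  rewrite -sum1_card [RHS]big_mkcond [LHS]big_mkcond; apply: eq_bigr => e _.
  by rewrite inE; case: (e \in edges G).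
rewrite mulnC mulnDr (mulnCA n 3) => /leq_trans; apply.
by rewrite leq_add ?leq_mul2l ?thin_le.
Qed.

(** * Complete graphs and their paths *)

Definition complete_graph (T : finType) : sgraph :=
  @SGraph T (fun x y => x != y) (fun x y => congr1 negb (eq_sym x y))
    (fun x => congr1 negb (eqxx x)).

Lemma complete_graphP (T : finType) : complete_graphs (complete_graph T).
Proof. by move=> x y /eqP. Qed.

Lemma edges_complete_graph (T : finType) (e : {set T}) :
  e \in edges (complete_graph T) <-> exists x y, x != y /\ e = [set x; y].
Proof.
split=> [/imsetP[[x y]] | [x [y [ne_xy ->]]]].
  by rewrite inE /= => ne_xy ->; exists x, y.
by apply/imsetP; exists (x, y); rewrite ?inE.
Qed.

Lemma card_edges_complete_graph (T : finType) :
  #|edges (complete_graph T)| = 'C(#|T|, 2).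
Proof.
rewrite -card_draws; apply: eq_card => e; rewrite inE.
by apply/idP/cards2P => /edges_complete_graph.
Qed.

Definition walk (T : finType) (f : nat -> T) (n : nat) :
    subgraph (complete_graph T) :=
  ([set v in mkseq f n.+1],
   [set e in [seq [set f i; f i.+1] | i <- iota 0 n]]).

Lemma in_walk (T : finType) (f : nat -> T) (n : nat) (e : {set T}) :
  e \in (walk f n).2 <-> exists2 i, i < n & e = [set f i; f i.+1].
Proof.
rewrite inE; split=> [/mapP[i] | [i lt_in ->]].
  by rewrite mem_iota => lt_in ->; exists i.
by apply/mapP; exists i; rewrite ?mem_iota.
Qed.

Lemma walk_is_path (T : finType) (f : nat -> T) (n : nat) :
  {in gtn n.+1 &, injective f} -> is_path (walk f n).
Proof.
move=> inj_f; exists (f 0), [seq f i | i <- iota 1 n].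
have -> : f 0 :: [seq f i | i <- iota 1 n] = mkseq f n.+1 by [].
have pathE m d :
    path (fun x y : T => x != y) (f m) [seq f i | i <- iota m.+1 d]
      = all (fun i => f i != f i.+1) (iota m d).
  by elim: d m => //= d IHd m; rewrite IHd.
have pairE m d :
    pairmap (fun u v => [set u; v]) (f m) [seq f i | i <- iota m.+1 d]
      = [seq [set f i; f i.+1] | i <- iota m d].
  by elim: d m => //= d IHd m; rewrite IHd.
split=> //; last by rewrite pairE.
  rewrite [path _ _ _]pathE.
  apply/allP => i; rewrite mem_iota /= => lt_in; apply/eqP => /inj_f.
  by rewrite !inE !ltnS ltnW // => /(_ isT lt_in); lia.
rewrite map_inj_in_uniq ?iota_uniq // => i j; rewrite !mem_iota /= => ? ?.
exact: inj_f.
Qed.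

(** * An orthogonal double cover of a complete graph of prime order *)

Lemma set2_eq (T : finType) (a b c d : T) : [set a; b] = [set c; d] ->
  (a = c /\ b = d) \/ (a = d /\ b = c).
Proof.
move=> eq_ab; have := set21 a b; have := set22 a b; rewrite eq_ab !inE.
have := set21 c d; have := set22 c d; rewrite -eq_ab !inE.
by do 4![case/orP=> /eqP ?]; subst; auto.
Qed.

Local Open Scope ring_scope.

Lemma Fp_has_prim_root (p : nat) : prime p ->
  exists g : 'F_p, p.-1.-primitive_root g.
Proof.
move=> p_prime; have p_gt1 := prime_gt1 p_prime.
pose rs := enum (predC1 (0 : 'F_p)).
suff /hasP[g _ g_prim] : has p.-1.-primitive_root rs by exists g.
apply: has_prim_root; first by rewrite -subn1 subn_gt0.
- apply/allP => x; rewrite mem_enum unity_rootE => nz_x.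
  apply/eqP/(mulfI nz_x); rewrite mulr1 -exprS prednK ?prime_gt0 //.
  by rewrite -{2}(expf_card x) card_Fp.
- by rewrite enum_uniq.
by rewrite -cardE cardC1 card_Fp.
Qed.

Lemma primitive_root_neq0 (p : nat) (g : 'F_p) :
  prime p -> p.-1.-primitive_root g -> g != 0.
Proof.
move=> p_prime g_prim; have p_gt1 := prime_gt1 p_prime.
apply: contra_eq_neq (prim_expr_order g_prim) => ->.
by rewrite expr0n; case: (p) p_gt1 => [|[|q]] //= _; rewrite eq_sym oner_eq0.
Qed.

(** The walk [a + 1, a + g, ..., a + g^(p-2)]; for a primitive root [g] it is
    the translate by [a] of a Hamilton path on the nonzero residues. *)
Definition power_path (p : nat) (g a : 'F_p) :=
  walk (fun i => a + g ^+ i) p.-2.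

(** The parameter [u] is a power of [g], hence any nonzero residue; the excluded
    value [g * u = 1] is the edge that would close the path into a cycle. *)
Lemma in_power_path (p : nat) (g a : 'F_p) (e : {set 'F_p}) :
    prime p -> p.-1.-primitive_root g ->
  e \in (power_path g a).2 <->
  exists u, [/\ u != 0, g * u != 1 & e = [set a + u; a + g * u]].
Proof.
move=> p_prime g_prim; have p_gt1 := prime_gt1 p_prime.
split=> [/in_walk[i lt_ip ->] | [u [nz_u gu_ne1 ->]]].
  exists (g ^+ i); rewrite -exprS; split=> //.
    by rewrite expf_neq0 // (primitive_root_neq0 p_prime g_prim).
  by rewrite -(prim_order_dvd g_prim) gtnNdvd //; lia.
have [i ui] : {i : 'I_p.-1 | u = g ^+ i}.
  apply: (prim_rootP g_prim); apply: (mulfI nz_u).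
  by rewrite mulr1 -exprS prednK ?prime_gt0 // -[RHS]expf_card card_Fp.
apply/in_walk; exists (i : nat); last by rewrite ui exprS.
have := ltn_ord i; suff : i.+1 <> p.-1 by lia.
move=> i_last; move/eqP: gu_ne1; apply.
by rewrite ui -exprS i_last (prim_expr_order g_prim).
Qed.

Lemma power_path_is_path (p : nat) (g a : 'F_p) :
  prime p -> p.-1.-primitive_root g -> is_path (power_path g a).
Proof.
move=> p_prime g_prim; have p_gt1 := prime_gt1 p_prime.
apply: walk_is_path => i j; rewrite !inE => lt_i lt_j /addrI /eqP.
by rewrite (eq_prim_root_expr g_prim) !modn_small; [move/eqP | lia..].
Qed.

(** A common edge of two distinct translates is traversed in opposite
    directions, since a difference [(g - 1) * u] determines [u]. So its
    parameters on the two paths are [u] and [- u], and comparing endpoints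
    determines [u]; in particular the common edge is unique if [g != -1]. *)
Lemma power_paths_meet (p : nat) (g a b : 'F_p) (e : {set 'F_p}) :
    prime p -> p.-1.-primitive_root g -> g != 1 -> a != b ->
    e \in (power_path g a).2 -> e \in (power_path g b).2 ->
  exists2 u, (g + 1) * u = b - a & e = [set a + u; a + g * u].
Proof.
move=> p_prime g_prim g_ne1 ne_ab.
move=> /(in_power_path _ _ p_prime g_prim)[u [_ _ ->]].
move=> /(in_power_path _ _ p_prime g_prim)[v [_ _ /set2_eq[]]] [eq1 eq2].
  have /eqP : (g - 1) * (u - v) = 0.
    transitivity ((a + g * u - (b + g * v)) - (a + u - (b + v))); first by ring.
    by rewrite eq1 eq2 !subrr.
  rewrite mulf_eq0 !subr_eq0 (negPf g_ne1) /= => /eqP uv.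
  by move: eq1; rewrite uv => /addIr /eqP; rewrite (negPf ne_ab).
have /eqP : (g - 1) * (u + v) = 0.
  transitivity ((a + g * u - (b + v)) - (a + u - (b + g * v))); first by ring.
  by rewrite eq1 eq2 !subrr.
rewrite mulf_eq0 subr_eq0 (negPf g_ne1) /= addr_eq0 => /eqP uv.
exists u => //; have -> : b = a + u - g * v by rewrite eq1; ring.
by rewrite uv; ring.
Qed.

(** The walk [c d, (c + 1) d, ..., (c + n) d]. *)
Definition chord_path (p : nat) (d c : 'F_p) (n : nat) :=
  walk (fun i => (c + i%:R) * d) n.

Lemma chord_path_is_path (p : nat) (d c : 'F_p) (n : nat) :
  prime p -> d != 0 -> (n < p)%N -> is_path (chord_path d c n).
Proof.
move=> p_prime nz_d lt_np; apply: walk_is_path => i j.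
rewrite !inE => lt_i lt_j /(mulIf nz_d) /addrI /(congr1 (@nat_of_ord _)).
by rewrite !val_Fp_nat // !modn_small; lia.
Qed.

(** The multiples of [d] exhaust the prime field, so the edges [{x, x + d}] form
    a Hamilton cycle. The first path is this cycle without the edge
    [{-d, 0}], the second path is that edge. *)
Lemma chord_pathsP (p : nat) (d : 'F_p) (e : {set 'F_p}) :
    prime p -> d != 0 ->
  (e \in (chord_path d 0 p.-1).2) || (e \in (chord_path d (-1) 1).2) <->
  exists x, e = [set x; x + d].
Proof.
move=> p_prime nz_d; have p_gt1 := prime_gt1 p_prime.
have stepE (c : 'F_p) i : (c + i.+1%:R) * d = (c + i%:R) * d + d.
  by rewrite -natr1; ring.
split=> [|[x ->]].
  by case/orP=> /in_walk[i _ ->]; eexists; rewrite stepE.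
pose i : nat := (x / d : 'F_p).
have xE : x = i%:R * d by rewrite natr_Zp divfK.
have lt_ip : (i < p)%N.
  by rewrite /i -[x / d]natr_Zp val_Fp_nat // ltn_pmod // ltnW.
have [lt_ip1 | ge_ip1] := ltnP i p.-1; apply/orP; [left | right]; apply/in_walk.
  by exists i => //; rewrite stepE add0r -xE.
exists 0 => //; rewrite stepE addr0 mulN1r xE.
have -> : i = p.-1 by lia.
have -> : p.-1%:R = -1 :> 'F_p.
  by apply/eqP; rewrite -subr_eq0 opprK natr1 prednK ?pchar_Fp_0 // ltnW.
by rewrite mulN1r.
Qed.

(** There are [p] power paths and two chord paths. The bound [3 < p] makes the
    order [p - 1] of a primitive root exceed 2, so that the root is neither [1]
    nor [-1] and distinct power paths share at most one edge. *)
Lemma strong_sep_num_complete_Fp (p : nat) : prime p -> (3 < p)%N ->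
  (strong_sep_num (complete_graph 'F_p) <= p + 2)%N.
Proof.
move=> p_prime p_gt3; have [g g_prim] := Fp_has_prim_root p_prime.
have nz_g := primitive_root_neq0 p_prime g_prim.
have g2_ne1 : g ^+ 2 != 1 by rewrite -(prim_order_dvd g_prim) gtnNdvd; lia.
have g_ne1 : g != 1 by apply: contraNneq g2_ne1 => ->; rewrite expr1n.
have nz_g1 : g + 1 != 0.
  apply: contraNneq g2_ne1 => /eqP; rewrite addr_eq0 => /eqP->.
  by rewrite sqrrN expr1n.
have nz_2 : (2%:R : 'F_p) != 0.
  by rewrite -(dvdn_pcharf (pchar_Fp p_prime)) gtnNdvd //; lia.
have nz_gB1 : g - 1 != 0 by rewrite subr_eq0.
pose d := 1 - g^-1.
have nz_d : d != 0 by rewrite subr_eq0 eq_sym invr_eq1.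
have dE : d = g^-1 * (g - 1) by rewrite /d; field.
pose powers := [set power_path g a | a : 'F_p].
pose chords := [set chord_path d 0 p.-1; chord_path d (-1) 1].
have [_ /(_ (powers :|: chords)) min] := strong_sep_numP (complete_graph 'F_p).
apply: leq_trans (min _) _; last first.
  rewrite (leq_trans (leq_card_setU _ _)) // leq_add //.
    by rewrite (leq_trans (leq_imset_card _ _)) // card_Fp.
  by rewrite cards2; case: (_ != _).
have powerE a e := in_power_path a e p_prime g_prim.
have power_mem a : power_path g a \in powers :|: chords.
  by rewrite inE imset_f.
split=> [H | e f].
  rewrite !inE => /or3P[/imsetP[a _ ->] | /eqP-> | /eqP->].
  - exact: power_path_is_path.
  - by apply: chord_path_is_path => //; lia.
  - by apply: chord_path_is_path => //; lia.
move=> /edges_complete_graph[x [y [ne_xy eE]]] _ ne_ef.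
have [/(chord_pathsP e p_prime nz_d) e_chord | e_nchord] :=
    pselect (exists x, e = [set x; x + d]).
  have [[z fE] | f_nchord] :=
    pselect (exists z, f = [set z; z + d]); last first.
    have [f0 f1] : f \notin (chord_path d 0 p.-1).2 /\
        f \notin (chord_path d (-1) 1).2.
      by apply/norP/negP => /(chord_pathsP f p_prime nz_d).
    case/orP: e_chord => e_in;
      [exists (chord_path d 0 p.-1) | exists (chord_path d (-1) 1)];
      by split=> //; rewrite !finset.in_setU !finset.in_set1 eqxx ?orbT.
  have [w eE'] := (chord_pathsP e p_prime nz_d).1 e_chord.
  (* Both orientations of [e] occur in the cycles; [w + d, w] has parameter
     [-1/g], so it survives in the path with base point [w + 1]. *)
  exists (power_path g (w + 1)); split=> //.
    apply/powerE; exists (- g^-1); rewrite oppr_eq0 invr_eq0 mulrN divff //.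
    split=> //; last by rewrite eE' addrK finset.setUC addrA.
    by apply: contraNneq nz_2 => n1; rewrite mulr2n -{1}n1 addNr.
  apply/negP => /powerE[u [_ gu_ne1]]; rewrite fE => /set2_eq[] [zE zdE].
    case/eqP: gu_ne1.
    have : d = (g - 1) * u by rewrite -(addKr z d) zdE zE; ring.
    by rewrite dE mulrC => /(mulfI nz_gB1) <-; rewrite divff.
  have : d = (1 - g) * u by rewrite -(addKr z d) zdE zE; ring.
  rewrite dE => /eqP.
  have -> : (1 - g) * u = (g - 1) * - u by ring.
  rewrite mulrC => /eqP /(mulfI nz_gB1) gu; case: ne_ef.
  have uE : u = - g^-1 by rewrite gu opprK.
  by rewrite eE' fE zE uE mulrN divff // addrK.
(* The remaining edges lie on two power paths, one for each orientation. *)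
pose u := (y - x) / (g - 1).
have yE : y = x + (g - 1) * u by rewrite /u mulrC divfK // addrC subrK.
have nz_u : u != 0 by rewrite mulf_neq0 ?invr_eq0 // subr_eq0 eq_sym.
have e_a : e \in (power_path g (x - u)).2.
  apply/powerE; exists u; split=> //; last first.
    by rewrite eE subrK yE; congr [set _; _]; ring.
  apply/eqP => gu1; case: e_nchord; exists x; rewrite eE; congr [set _; _].
  rewrite yE dE mulrC; congr (_ + _ * _).
  by apply: (mulfI nz_g); rewrite gu1 divff.
have e_b : e \in (power_path g (y + u)).2.
  apply/powerE; exists (- u); split; rewrite ?oppr_eq0 //; last first.
    by rewrite eE finset.setUC addrK yE; congr [set _; _]; ring.
  apply/eqP => gu1; case: e_nchord; exists y.
  rewrite eE finset.setUC; congr [set _; _].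
  have -> : d = (g - 1) * - u.
    by rewrite dE mulrC; congr (_ * _); apply: (mulfI nz_g); rewrite gu1 divff.
  by rewrite yE; ring.
have ab : (y + u) - (x - u) = (g + 1) * u by rewrite yE; ring.
have ne_ab : x - u != y + u by rewrite eq_sym -subr_eq0 ab mulf_neq0.
have [f_a | f_na] := boolP (f \in (power_path g (x - u)).2); last first.
  by exists (power_path g (x - u)).
have [f_b | f_nb] := boolP (f \in (power_path g (y + u)).2); last first.
  by exists (power_path g (y + u)).
have [v vE eE'] := power_paths_meet p_prime g_prim g_ne1 ne_ab e_a e_b.
have [v' v'E fE] := power_paths_meet p_prime g_prim g_ne1 ne_ab f_a f_b.
case: ne_ef; rewrite eE' fE; suff /(mulfI nz_g1)-> : (g + 1) * v = (g + 1) * v'.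
  by [].
by rewrite vE v'E.
Qed.

(** * The separation ratio *)

Lemma rainbow_sep_num_complete (k p : nat) (T : finType) :
    (2 <= k)%N -> #|T| = p -> (3 < p)%N ->
  (3 * p <= 2 * rainbow_sep_num k (complete_graph T) + 9 * k)%N.
Proof.
move=> k_ge2 cardT p_gt3.
have [[P rsps] _] := rainbow_sep_numP (complete_graph T) k_ge2.
have binE := mul_bin_diag p 1; rewrite bin1 in binE.
have := rsps_lower_bound rsps; rewrite card_edges_complete_graph cardT.
set m := rainbow_sep_num _ _; set b := 'C(p, 2) in binE * => bound.
have {}bound : (3 * b <= m * (p.-1 + 3 * k))%N by apply: bound; nia.
(* This is [3 p (p - 1) <= 2 m (p - 1 + 3 k)], and expanding shows that
   [(3 p - 9 k) (p - 1 + 3 k) <= 3 p (p - 1)]. *)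
nia.
Qed.

(** Positivity matters because dividing by [0] would make the ratio [0]. *)
Lemma strong_sep_num_gt0 (G : sgraph) :
  (1 < #|edges G|)%N -> (0 < strong_sep_num G)%N.
Proof.
move=> /card_gt1P[e [f [Ee Ef /eqP ne_ef]]].
have [[S [_ sep] <-] _] := strong_sep_numP G.
have [H [SH _ _]] := sep e f Ee Ef ne_ef.
by apply/card_gt0P; exists H.
Qed.

Lemma rainbow_ratio_complete_Fp (R : realType) (k p : nat) :
    (2 <= k)%N -> prime p -> (3 < p)%N ->
  3%:R / 2%:R - (6 * k)%:R / p%:R <= rainbow_ratio R k (complete_graph 'F_p).
Proof.
move=> k_ge2 p_prime p_gt3; rewrite /rainbow_ratio.
have m_ge := rainbow_sep_num_complete k_ge2 (card_Fp p_prime) p_gt3.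
have s_le := strong_sep_num_complete_Fp p_prime p_gt3.
have s_gt0 : (0 < strong_sep_num (complete_graph 'F_p))%N.
  apply: strong_sep_num_gt0; rewrite card_edges_complete_graph card_Fp //.
  by have := mul_bin_diag p 1; rewrite bin1; nia.
set m := rainbow_sep_num _ _ in m_ge *.
set s := strong_sep_num _ in s_le s_gt0 *.
have {s_le} s_leR : s%:R <= p%:R + 2%:R :> R by rewrite -natrD ler_nat.
have {s_gt0} s_gt0R : 0 < s%:R :> R by rewrite ltr0n.
have p_gt0R : 0 < p%:R :> R by rewrite ltr0n; lia.
(* The constant [6 k] is chosen so that [9 k + 6 <= 2 * (6 k)] for [k >= 2]. *)
have m_geR : 3%:R * p%:R + 6%:R <= 2%:R * m%:R + 2%:R * (6 * k)%:R :> R.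
  by rewrite -!natrM -!natrD ler_nat; lia.
rewrite ler_pdivlMr //; set c := (6 * k)%:R / p%:R : R.
have cE : (6 * k)%:R = c * p%:R by rewrite /c divfK ?gt_eqF.
have c_ge0 : 0 <= c by rewrite divr_ge0 ?ler0n.
have [neg | pos] := lerP (3%:R / 2%:R - c) 0.
  by rewrite (le_trans (mulr_le0_ge0 neg (ltW s_gt0R))) ?ler0n.
apply: le_trans (ler_wpM2l (ltW pos) s_leR) _.
move: m_geR; rewrite cE; lra.
Qed.

Local Close Scope ring_scope.

Theorem theorem4p1 (R : realType) (k : nat) (hk : (2 <= k)%N) :
  (((3%:R / 2%:R)%R : R)%:E <= class_rainbow_ratio R k complete_graphs)%E.
Proof.
apply: le_ereal_inf_tmp => _ [N _ <-]; apply/lee_addgt0Pr => eps eps_gt0.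
pose B := Num.bound ((6 * k)%:R / eps : R)%R.
have [p p_big p_prime] := prime_above (maxn 3 (maxn N B)).
move: p_big; rewrite !gtn_max => /and3P[p_gt3 p_gtN p_gtB].
rewrite -leeBlDr //; apply: le_ereal_sup_tmp.
exists (rainbow_ratio R k (complete_graph 'F_p))%:E; last first.
  rewrite -EFinB lee_fin.
  apply: le_trans (rainbow_ratio_complete_Fp R hk p_prime p_gt3).
  rewrite lerB // ler_pdivrMr ?ltr0n ?prime_gt0 // mulrC -ler_pdivrMr //.
  apply: le_trans (ltW (archi_boundP _)) _.
    by rewrite divr_ge0 ?ler0n ?ltW.
  by rewrite ler_nat ltnW.
exists (complete_graph 'F_p); split=> //.
- exact: complete_graphP.
- rewrite card_edges_complete_graph card_Fp //.
  by have := mul_bin_diag p 1; rewrite bin1; nia.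
- by rewrite card_Fp // ltnW.
Qed.
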